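(* Assume $\langle f\rangle_X=0$ and that $\psi$ satisfies (A1) and (A2), and let $e_{\rm mod}$ be the modeling error. Then: (a) there exists a constant $C_{10}$ such that $\|e_{\rm mod}\|_{L^2}\le\frac1{2\sqrt3}|e_{\rm mod}|_{H^1}\le C_{10}H|f|_{H^{-1}}$; (b) if additionally there are constants $C_{\rm coll},C''_{\psi^0}$ with $\bigl|X_{i_k^{\rm coll}}-\frac{X_{i_k}+X_{i_{k+1}-1}}2\bigr|\le\epsilon C_{\rm coll}$ for all $k$ and $\|D^2\psi^0\|_{L^\infty}\le C''_{\psi^0}$, then there exist constants $C_{11},C_{12}$ such that $\|e_{\rm mod}\|_{L^2}\le\frac1{2\sqrt3}|e_{\rm mod}|_{H^1}\le(C_{11}H^2+C_{12}\epsilon)|f|_{H^{-1}}$; (c) if $\psi(X_i,Y_j)$ does not depend on $X_i$, then $e_{\rm mod}=0$. Here the constants depend only on $c_\psi,C_\psi,C'_\psi,C_{\rm coll},C''_{\psi^0}$ and $p$, and are independent of $\epsilon$, $H$ and $f$.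
   Context: Let $\epsilon>0$, $N,p$ positive integers with normalization $N\epsilon=1$; $X_i=\epsilon i$, $Y_j=j$. $U^N_{\rm per}(\epsilon\mathbb Z)$: functions $u:\epsilon\mathbb Z\to\mathbb R$ with $u(X_{i+N})=u(X_i)$; $U^N_\#(\epsilon\mathbb Z)$: those with $\langle u\rangle_X:=\frac1N\sum_{i=1}^Nu(X_i)=0$. $\langle u,v\rangle_X=\frac1N\sum_{i=1}^Nu(X_i)v(X_i)$, $Du(X_i)=(u(X_{i+1})-u(X_i))/\epsilon$, $\|u\|_{L^2}=\langle u,u\rangle_X^{1/2}$, $\|u\|_{L^\infty}=\max_{1\le i\le N}|u(X_i)|$, $|u|_{H^1}=\|Du\|_{L^2}$, $|u|_{H^{-1}}=\sup\{\langle u,w\rangle_X/|w|_{H^1}:0\ne w\in U^N_\#(\epsilon\mathbb Z)\}$. $U^p_\#(\epsilon\mathbb Z)$: $p$-periodic functions on $\epsilon\mathbb Z$ with $\sum_{i=1}^p w(X_i)=0$. Two-scale functions $g:\epsilon\mathbb Z\times\mathbb Z\to\mathbb R$ satisfy $g(X_{i+N},Y_j)=g(X_i,Y_j)=g(X_i,Y_{j+p})$; $D_Xg(X_i,Y_j)=(g(X_{i+1},Y_j)-g(X_i,Y_j))/\epsilon$, $\langle g\rangle_Y(X_i)=\frac1p\sum_{j=1}^pg(X_i,Y_j)$, $\|g\|_{L^\infty(N,p)}=\max_{1\le i\le N,1\le j\le p}|g|$. $\psi$ is a two-scale function with (A1) $0<c_\psi\le\psi\le C_\psi$ and (A2) $\|D_X\psi\|_{L^\infty(N,p)}\le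 C'_\psi$. $\psi^0(X_i)=\langle1/\psi(X_i,\cdot)\rangle_Y^{-1}$. $f\in U^N_{\rm per}(\epsilon\mathbb Z)$. HQC method: fix indices $1=i_1<\dots<i_K\le N$, $i_{K+1}=N+1$, elements $S_k=\{X_i:i_k\le i<i_{k+1}\}$, $H_k=\epsilon(i_{k+1}-i_k)$, $H=\max_kH_k$. $U^H_{\rm per}$: $v\in U^N_{\rm per}(\epsilon\mathbb Z)$ affine on each $\{X_i:i_k\le i\le i_{k+1}\}$; $U^H_\#=U^H_{\rm per}\cap U^N_\#(\epsilon\mathbb Z)$. In each $S_k$ choose a sampling domain $S_k^{\rm rep}=\{X_i:i_k^{\rm rep}\le i<i_k^{\rm rep}+p\}\subset S_k$ and a collocation index with $X_{i_k^{\rm coll}}\in S_k^{\rm rep}$; $\psi^\epsilon_{{\rm coll},k}(X_i)=\psi(X_{i_k^{\rm coll}},X_i/\epsilon)$, $\langle a,b\rangle_{S_k^{\rm rep}}=\frac1p\sum_{X_i\in S_k^{\rm rep}}a(X_i)b(X_i)$. For $v^H\in U^H_{\rm per}$ let $\ell_k$ be the affine function on $\epsilon\mathbb Z$ equal to $v^H$ on $S_k$; $\mathcal R_k(v^H)=\ell_k+w$ with $w\in U^p_\#(\epsilon\mathbb Z)$ such that $\langle\psi^\epsilon_{{\rm coll},k}D(\ell_k+w),Ds\rangle_{S_k^{\rm rep}}=0$ for all $s\in U^p_\#(\epsilon\mathbb Z)$. HQC problem: $u^H\in U^H_\#$ with $\sum_{k=1}^KH_k\langle\psi^\epsilon_{{\rm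 coll},k}D\mathcal R_k(u^H),D\mathcal R_k(v^H)\rangle_{S_k^{\rm rep}}=\langle f,v^H\rangle_X$ for all $v^H\in U^H_\#$. Modeling error: $e_{\rm mod}=u^H-\tilde u^H$, where $\tilde u^H\in U^H_\#$ solves $\langle\psi^0D\tilde u^H,Dv^H\rangle_X=\langle f,v^H\rangle_X$ for all $v^H\in U^H_\#$. *)

(* Defs.v *)
From Stdlib Require Import ClassicalEpsilon.
From mathcomp Require Import all_boot all_order all_algebra.
From mathcomp Require Import boolp classical_sets reals.
Set Implicit Arguments. Unset Strict Implicit. Unset Printing Implicit Defensive.
Import Order.TTheory GRing.Theory Num.Theory.
Local Open Scope classical_set_scope.
Local Open Scope ring_scope.

(* Conventions: N eps = 1, so eps = 1/N and X_i = eps * i.  A function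
   u : eps Z -> R is represented by its values at the grid points, i.e.
   by the map i |-> u(X_i) of type int -> R.  A two-scale function g is
   represented by (i,j) |-> g(X_i, Y_j), of type int -> int -> R.
   Mesh indices i_k, sampling indices i_k^rep and collocation indices
   i_k^coll are given by functions nat -> nat, used for k = 1..K. *)

Section Defs.
Context {R : realType}.

Definition eps (N : nat) : R := (N%:R)^-1.
Definition Xpt (N : nat) (i : int) : R := eps N * i%:~R.

Definition Uper (N : nat) (u : int -> R) : Prop := forall i, u (i + N%:Z) = u i.
Definition meanX (N : nat) (u : int -> R) : R :=
  (N%:R)^-1 * \sum_(1 <= i < N.+1) u i%:Z.
Definition Usharp (N : nat) (u : int -> R) : Prop := Uper N u /\ meanX N u = 0.

Definition Upsharp (p : nat) (w : int -> R) : Prop :=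
  (forall i, w (i + p%:Z) = w i) /\ \sum_(1 <= i < p.+1) w i%:Z = 0.

Definition dotX (N : nat) (u v : int -> R) : R :=
  (N%:R)^-1 * \sum_(1 <= i < N.+1) u i%:Z * v i%:Z.
Definition Dop (N : nat) (u : int -> R) : int -> R :=
  fun i => (u (i + 1) - u i) / eps N.
Definition L2norm (N : nat) (u : int -> R) : R := Num.sqrt (dotX N u u).
Definition Linfnorm (N : nat) (u : int -> R) : R :=
  \big[Num.max/0]_(1 <= i < N.+1) `|u i%:Z|.
Definition H1semi (N : nat) (u : int -> R) : R := L2norm N (Dop N u).
Definition Hm1semi (N : nat) (u : int -> R) : R :=
  sup [set x : R | exists w : int -> R,
        [/\ Usharp N w, w <> (fun _ => 0) & x = dotX N u w / H1semi N w]].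

Definition two_scale (N p : nat) (g : int -> int -> R) : Prop :=
  forall i j, g (i + N%:Z) j = g i j /\ g i (j + p%:Z) = g i j.
Definition DX (N : nat) (g : int -> int -> R) : int -> int -> R :=
  fun i j => (g (i + 1) j - g i j) / eps N.
Definition Linf2 (N p : nat) (g : int -> int -> R) : R :=
  \big[Num.max/0]_(1 <= i < N.+1) \big[Num.max/0]_(1 <= j < p.+1) `|g i%:Z j%:Z|.

Definition A1 (cpsi Cpsi : R) (psi : int -> int -> R) : Prop :=
  0 < cpsi /\ forall i j, cpsi <= psi i j <= Cpsi.
Definition A2 (N p : nat) (Cpsi' : R) (psi : int -> int -> R) : Prop :=
  Linf2 N p (DX N psi) <= Cpsi'.

Definition psi0 (p : nat) (psi : int -> int -> R) : int -> R :=
  fun i => ((p%:R)^-1 * \sum_(1 <= j < p.+1) (psi i j%:Z)^-1)^-1.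

(* HQC mesh: 1 = i_1 < ... < i_K <= N, i_{K+1} = N+1, sampling domains
   S_k^rep = {X_i : i_k^rep <= i < i_k^rep + p} subset S_k, collocation
   index i_k^coll with X_{i_k^coll} in S_k^rep. *)
Definition hqc_mesh (N p K : nat) (idx rep coll : nat -> nat) : Prop :=
  [/\ (0 < K)%N, idx 1%N = 1%N,
      (forall k, (1 <= k < K)%N -> (idx k < idx k.+1)%N),
      (idx K <= N)%N & idx K.+1 = N.+1] /\
      forall k, (1 <= k <= K)%N ->
        [/\ (idx k <= rep k)%N, (rep k + p <= idx k.+1)%N &
            (rep k <= coll k < rep k + p)%N].

Definition Hk (N : nat) (idx : nat -> nat) (k : nat) : R :=
  eps N * (idx k.+1 - idx k)%N%:R.
Definition Hmax (N K : nat) (idx : nat -> nat) : R :=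
  \big[Num.max/0]_(1 <= k < K.+1) Hk N idx k.

Definition UHper (N K : nat) (idx : nat -> nat) (v : int -> R) : Prop :=
  Uper N v /\
  forall k, (1 <= k <= K)%N -> exists a b : R,
    forall i : nat, (idx k <= i <= idx k.+1)%N -> v i%:Z = a + b * Xpt N i%:Z.
Definition UHsharp (N K : nat) (idx : nat -> nat) (v : int -> R) : Prop :=
  UHper N K idx v /\ meanX N v = 0.

(* l_k: the affine function on eps Z equal to v^H on S_k (the affine
   function through the values of v^H at the element end points X_{i_k},
   X_{i_{k+1}}, on which v^H is affine). *)
Definition ell (N : nat) (idx : nat -> nat) (k : nat) (v : int -> R) : int -> R :=
  fun i => v (idx k)%:Z +
    (Xpt N i - Xpt N (idx k)%:Z) * ((v (idx k.+1)%:Z - v (idx k)%:Z) / Hk N idx k).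

Definition psi_coll (psi : int -> int -> R) (coll : nat -> nat) (k : nat) : int -> R :=
  fun i => psi (coll k)%:Z i.

Definition dotrep (p : nat) (rep : nat -> nat) (k : nat) (a b : int -> R) : R :=
  (p%:R)^-1 * \sum_(rep k <= i < rep k + p) a i%:Z * b i%:Z.

Definition is_recon (N p : nat) (idx rep coll : nat -> nat) (psi : int -> int -> R)
    (k : nat) (v r : int -> R) : Prop :=
  exists w : int -> R,
    [/\ Upsharp p w, r = (fun i => ell N idx k v i + w i) &
        forall s, Upsharp p s ->
          dotrep p rep k (fun i => psi_coll psi coll k i * Dop N r i) (Dop N s) = 0].

(* The reconstruction operator (the cell problem has a unique solution). *)
Definition Recon (N p : nat) (idx rep coll : nat -> nat) (psi : int -> int -> R)
    (k : nat) (v : int -> R) : int -> R :=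
  epsilon (inhabits (fun _ => 0)) (is_recon N p idx rep coll psi k v).

Definition HQC_sol (N p K : nat) (idx rep coll : nat -> nat) (psi : int -> int -> R)
    (f uH : int -> R) : Prop :=
  UHsharp N K idx uH /\
  forall vH, UHsharp N K idx vH ->
    \sum_(1 <= k < K.+1) Hk N idx k *
       dotrep p rep k
         (fun i => psi_coll psi coll k i * Dop N (Recon N p idx rep coll psi k uH) i)
         (Dop N (Recon N p idx rep coll psi k vH))
    = dotX N f vH.

Definition hom_sol (N p K : nat) (idx : nat -> nat) (psi : int -> int -> R)
    (f ut : int -> R) : Prop :=
  UHsharp N K idx ut /\
  forall vH, UHsharp N K idx vH ->
    dotX N (fun i => psi0 p psi i * Dop N ut i) (Dop N vH) = dotX N f vH.

Definition emod (uH ut : int -> R) : int -> R := fun i => uH i - ut i.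

End Defs.

(* Main.v *)
From Stdlib Require Import ClassicalEpsilon.
Require Import Defs.
From mathcomp Require Import all_boot all_order all_algebra.
From mathcomp Require Import boolp classical_sets reals.
From mathcomp Require Import zify ring lra.
Import Order.TTheory GRing.Theory Num.Theory.
Local Open Scope ring_scope.

(** The cell problem forces the flux [psi D R_k(v)] to be constant on the sampling
    domain, so both discrete problems become sums over the elements of [H_k]
    times the product of the slopes of trial and test function, weighted by
    [psi0] at the collocation point (HQC) or by the mean of [psi0] over the
    element (homogenized problem).  If these weights differ by at most [d],
    testing with the error gives [|e_mod|_{H^1} <= d / cpsi^2 |f|_{H^-1}].
    Here [d = O(H)] because [psi0] is Lipschitz, [d = O(H^2 + eps)] by a second
    order Taylor expansion when the collocation point is close to the centre of
    the element, and [d = 0] when [psi0] is constant.  The Poincare constant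
    [1 / (2 sqrt 3)] comes from Cauchy-Schwarz applied to
    [N u_i = sum_{m < N} (m + 1 - (N + 1)/2) (u_{i+m+1} - u_{i+m})], whose
    weights have square sum [N (N^2 - 1) / 12]. *)

Lemma intS (n : nat) : n.+1%:Z = n%:Z + 1.
Proof. by rewrite -addn1 PoszD. Qed.

(** * Sums of periodic functions over windows of consecutive integers *)

Section PeriodicSums.
Context {V : zmodType}.
Implicit Types (u h : int -> V) (a b : int) (s n : nat).

Lemma sum_nat_shift n s h :
  \sum_(s <= i < s + n) h i%:Z = \sum_(m < n) h (s%:Z + m%:Z).
Proof.
rewrite -{1}[s]add0n big_addn addKn big_mkord.
by apply: eq_bigr => m _; rewrite addnC PoszD.
Qed.

Lemma sum_nat1_shift n h :
  \sum_(1 <= i < n.+1) h i%:Z = \sum_(m < n) h (1 + m%:Z).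
Proof. by rewrite -sum_nat_shift add1n. Qed.

Lemma sum_telescope n a u :
  \sum_(m < n) (u (a + m%:Z + 1) - u (a + m%:Z)) = u (a + n%:Z) - u a.
Proof.
elim: n => [|n IH]; first by rewrite big_ord0 addr0 subrr.
by rewrite big_ord_recr /= IH intS (addrA a) [LHS]addrC subrKA.
Qed.

(** Moving the window by one step changes the sum by [h (c + n) - h c], which periodicity makes
    zero. *)
Lemma sum_period n h a b : (forall i, h (i + n%:Z) = h i) ->
  \sum_(m < n) h (a + m%:Z) = \sum_(m < n) h (b + m%:Z).
Proof.
move=> hper.
have step c : \sum_(m < n) h (c + 1 + m%:Z) = \sum_(m < n) h (c + m%:Z).
  apply/eqP; rewrite -subr_eq0 -sumrB; apply/eqP.
  have := sum_telescope n c h; rewrite hper subrr; apply: etrans.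
  by apply: eq_bigr => m _; rewrite addrAC.
have base c : \sum_(m < n) h (c + m%:Z) = \sum_(m < n) h (0 + m%:Z).
  elim/int_rect: c => // k <-; first by rewrite intS step.
  by rewrite -step intS opprD addrNK.
by rewrite base [RHS]base.
Qed.

End PeriodicSums.

(** * Inverting the forward difference on periodic functions of mean zero *)

Section PeriodicPrimitive.
Context {F : numFieldType}.
Implicit Types (u g : int -> F) (n : nat).

(** Summation by parts: the boundary term is [n * u i] by periodicity, and what remains is the
    vanishing sum of [u] over a period. *)
Lemma mean_zero_diff n u i :
  (forall i, u (i + n%:Z) = u i) -> \sum_(m < n) u (i + m%:Z) = 0 ->
  n%:R * u i = \sum_(m < n) m.+1%:R * (u (i + m%:Z + 1) - u (i + m%:Z)).
Proof.
move=> uper usum.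
have H : forall k, \sum_(m < k) m.+1%:R * (u (i + m%:Z + 1) - u (i + m%:Z))
    = k%:R * u (i + k%:Z) - \sum_(m < k) u (i + m%:Z).
  elim=> [|k IH]; first by rewrite !big_ord0 mul0r subrr.
  by rewrite !big_ord_recr /= IH intS !addrA -!natr1; ring.
by rewrite H usum uper subr0.
Qed.

(** The formula of [mean_zero_diff] solved for [u], with [g] in place of the increments. It is
    defined on all integers at once and already has mean zero for periodic mean-zero [g], so no
    integration constant has to be adjusted. *)
Definition primitive n g : int -> F :=
  fun i => (n%:R)^-1 * \sum_(m < n) m.+1%:R * g (i + m%:Z).

Lemma primitive_per n g : (forall i, g (i + n%:Z) = g i) ->
  forall i, primitive n g (i + n%:Z) = primitive n g i.
Proof.
move=> gper i; rewrite /primitive; congr (_ * _); apply: eq_bigr => m _.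
by rewrite addrAC gper.
Qed.

Lemma primitive_diff n g : (0 < n)%N -> (forall i, g (i + n%:Z) = g i) ->
  \sum_(m < n) g (0 + m%:Z) = 0 ->
  forall i, primitive n g (i + 1) - primitive n g i = g i.
Proof.
move=> n0 gper gsum i; rewrite /primitive -mulrBr -sumrB.
have H : forall k, \sum_(m < k)
      (m.+1%:R * g (i + 1 + m%:Z) - m.+1%:R * g (i + m%:Z))
    = k%:R * g (i + k%:Z) - \sum_(m < k) g (i + m%:Z).
  elim=> [|k IH]; first by rewrite !big_ord0 mul0r subrr.
  rewrite !big_ord_recr /= IH intS (addrAC i 1) !addrA -!natr1; ring.
rewrite H gper (sum_period n g i 0) // gsum subr0 mulKf //.
by rewrite pnatr_eq0 -lt0n.
Qed.

Lemma primitive_sum n g a : (forall i, g (i + n%:Z) = g i) ->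
  \sum_(m < n) g (0 + m%:Z) = 0 -> \sum_(j < n) primitive n g (a + j%:Z) = 0.
Proof.
move=> gper gsum; rewrite /primitive -mulr_sumr exchange_big /=.
rewrite big1 ?mulr0 // => m _; rewrite -mulr_sumr.
under eq_bigr do rewrite addrAC.
by rewrite (sum_period n g _ 0) // gsum mulr0.
Qed.

End PeriodicPrimitive.

(** * Weighted Cauchy-Schwarz inequality for finite sums *)

Section CauchySchwarz.
Context {F : realFieldType} {I : Type}.
Implicit Types (r : seq I) (w x y : I -> F).

Lemma wsum_sqr_ge0 r w x : (forall i, 0 <= w i) ->
  0 <= \sum_(i <- r) w i * x i ^+ 2.
Proof. by move=> w0; apply: sumr_ge0 => i _; rewrite mulr_ge0 ?sqr_ge0. Qed.

(** The weights will be [1 / N] in [dotX], the element sizes in sums over the mesh, and 1 in the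
    Poincare inequality. *)
Lemma wsum_cauchy_schwarz r w x y : (forall i, 0 <= w i) ->
  (\sum_(i <- r) w i * (x i * y i)) ^+ 2
    <= (\sum_(i <- r) w i * x i ^+ 2) * (\sum_(i <- r) w i * y i ^+ 2).
Proof.
move=> w0; set B := \sum_(i <- r) w i * (x i * y i).
set A := \sum_(i <- r) w i * x i ^+ 2; set C := \sum_(i <- r) w i * y i ^+ 2.
have quad (s t : F) : 0 <= s ^+ 2 * A + 2 * s * t * B + t ^+ 2 * C.
  have := wsum_sqr_ge0 r w (fun i => s * x i + t * y i) w0.
  rewrite /A /B /C !mulr_sumr -!big_split /=.
  by congr (0 <= _); apply: eq_bigr => i _; ring.
have A0 : 0 <= A by exact: wsum_sqr_ge0.
(* If [A] is nonzero, the form at [(B, - A)] equals [A * (A * C - B ^+ 2)]. If [A = 0], its value at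
   [(- (C + 1), B)] is [- B ^+ 2 * (C + 2)], which forces [B = 0]. *)
have [A1|A1] := eqVneq A 0; last first.
  have Ap : 0 < A by rewrite lt_def A1.
  have := quad B (- A).
  rewrite (_ : _ + _ = A * (A * C - B ^+ 2)); last by ring.
  by rewrite pmulr_rge0 // subr_ge0.
rewrite A1 mul0r; have := quad (- (C + 1)) B; rewrite A1.
have C0 : 0 <= C by exact: wsum_sqr_ge0.
have := sqr_ge0 B; nra.
Qed.

End CauchySchwarz.

Lemma sum_centered_sqr {F : numFieldType} (n : nat) :
  \sum_(m < n) (m.+1%:R - n.+1%:R / 2 : F) ^+ 2 = n%:R * (n%:R ^+ 2 - 1) / 12.
Proof.
(* The centre is a fixed [c] during the induction, since [(n + 1) / 2] moves with [n]. *)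
have H (c : F) : forall k, \sum_(m < k) (m.+1%:R - c) ^+ 2
    = k%:R * (k%:R + 1) * (2 * k%:R + 1) / 6
      - c * k%:R * (k%:R + 1) + k%:R * c ^+ 2.
  elim=> [|k IH]; first by rewrite big_ord0; field.
  by rewrite big_ord_recr /= IH -!natr1; field.
by rewrite H -natr1; field.
Qed.

(** * Discrete norms, the Poincare inequality and the dual norm *)

Section Norms.
Context {R : realType} {N : nat} (N0 : (0 < N)%N).
Implicit Types (u v f : int -> R).

Let NR0 : (N%:R : R) != 0. Proof. by rewrite pnatr_eq0 -lt0n. Qed.
Let NRp : 0 < (N%:R : R). Proof. by rewrite ltr0n. Qed.

Lemma dotXE u v :
  dotX N u v = (N%:R)^-1 * \sum_(m < N) u (1 + m%:Z) * v (1 + m%:Z).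
Proof. by rewrite /dotX (sum_nat1_shift N (fun i => u i * v i)). Qed.

Lemma dotX_ge0 u : 0 <= dotX N u u.
Proof.
rewrite dotXE mulr_ge0 ?invr_ge0 ?ler0n // sumr_ge0 // => m _.
by rewrite -expr2 sqr_ge0.
Qed.

Lemma L2norm_sqr u : L2norm N u ^+ 2 = dotX N u u.
Proof. by rewrite sqr_sqrtr ?dotX_ge0. Qed.

Lemma H1semi_sqr u : H1semi N u ^+ 2 = dotX N (Dop N u) (Dop N u).
Proof. exact: L2norm_sqr. Qed.

Lemma H1semi_ge0 u : 0 <= H1semi N u.
Proof. exact: sqrtr_ge0. Qed.

Lemma dotX_cauchy_schwarz u v : dotX N u v <= L2norm N u * L2norm N v.
Proof.
rewrite (le_trans (ler_norm _)) // -[leRHS]ger0_norm ?mulr_ge0 ?sqrtr_ge0 //.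
rewrite -ler_sqr ?nnegrE ?normr_ge0 // !real_normK ?num_real //.
rewrite [leRHS]exprMn !L2norm_sqr /dotX.
have := wsum_cauchy_schwarz (index_iota 1 N.+1) (fun=> N%:R^-1)
  (fun i => u i%:Z) (fun i => v i%:Z).
by rewrite -!mulr_sumr; apply=> _; rewrite invr_ge0 ltW.
Qed.

(** The factor [N] is the [1 / N] of the mean times the [N ^+ 2] of the difference quotients. The
    free starting point [i] serves the pointwise Poincare bound at [i]. *)
Lemma H1semi_sqrE u : Uper N u -> forall i,
  H1semi N u ^+ 2 = N%:R * \sum_(m < N) (u (i + m%:Z + 1) - u (i + m%:Z)) ^+ 2.
Proof.
move=> uper i; rewrite H1semi_sqr dotXE.
rewrite -(sum_period N (fun i => (u (i + 1) - u i) ^+ 2) 1); last first.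
  by move=> j; rewrite addrAC !uper.
rewrite !mulr_sumr; apply: eq_bigr => m _; rewrite /Dop /eps; field.
exact: NR0.
Qed.

Lemma Usharp_sum u : Usharp N u -> forall i, \sum_(m < N) u (i + m%:Z) = 0.
Proof.
move=> [uper]; rewrite /meanX => /eqP.
rewrite mulf_eq0 invr_eq0 (negPf NR0) /= sum_nat1_shift => /eqP u0 i.
by rewrite (sum_period N u i 1).
Qed.

Lemma poincare_pointwise u : Usharp N u -> forall i,
  u i ^+ 2 <= H1semi N u ^+ 2 / 12.
Proof.
move=> us i; have [uper _] := us.
have usum := Usharp_sum u us i.
rewrite (H1semi_sqrE u uper i).
pose d (m : 'I_N) := u (i + m%:Z + 1) - u (i + m%:Z).
(* Subtracting the mean weight changes nothing, as the increments sum to zero, and it minimizes the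
   sum of squares. *)
pose c (m : 'I_N) : R := m.+1%:R - N.+1%:R / 2.
have dsum : \sum_m d m = 0 by rewrite sum_telescope uper subrr.
have E : N%:R * u i = \sum_m 1 * (c m * d m).
  rewrite (mean_zero_diff N u i uper usum) -[LHS]subr0.
  rewrite -[X in _ - X = _](mulr0 (N.+1%:R / 2)) -[X in _ - _ * X = _]dsum.
  rewrite mulr_sumr -sumrB.
  by apply: eq_bigr => m _; rewrite /c mul1r mulrBl.
have := wsum_cauchy_schwarz (index_enum 'I_N) (fun=> 1) c d (fun=> ler01).
rewrite -E.
have -> : \sum_m 1 * c m ^+ 2 = N%:R * (N%:R ^+ 2 - 1) / 12.
  by rewrite -sum_centered_sqr; apply: eq_bigr => m _; rewrite mul1r.
under eq_bigr do rewrite mul1r.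
set T := \sum_m d m ^+ 2.
have T0 : 0 <= T by apply: sumr_ge0 => m _; rewrite sqr_ge0.
move=> H; rewrite -(ler_pM2l (exprn_gt0 2 NRp)) -exprMn (le_trans H) //.
(* The slack comes from replacing [N ^+ 2 - 1] by [N ^+ 2]. *)
rewrite -subr_ge0 (_ : _ - _ = N%:R * T / 12); last by field.
by rewrite divr_ge0 // mulr_ge0 // ltW.
Qed.

(** The pointwise bound is averaged over one period; [12] is the square of [2 * sqrt 3]. *)
Lemma poincare u : Usharp N u -> L2norm N u <= (2 * Num.sqrt 3)^-1 * H1semi N u.
Proof.
move=> us; have s3 : 0 < Num.sqrt (3 : R) by rewrite sqrtr_gt0.
have c0 : 0 <= (2 * Num.sqrt (3 : R))^-1 by rewrite invr_ge0 mulr_ge0 // ltW.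
rewrite -ler_sqr ?nnegrE ?mulr_ge0 ?H1semi_ge0 ?sqrtr_ge0 // L2norm_sqr.
rewrite exprMn exprVn exprMn sqr_sqrtr // dotXE.
rewrite ler_pdivrMl //.
apply: (@le_trans _ _ (\sum_(m < N) H1semi N u ^+ 2 / 12)).
  by apply: ler_sum => m _; rewrite -expr2 poincare_pointwise.
rewrite sumr_const card_ord -[leLHS]mulr_natl (_ : 2 ^+ 2 * 3 = 12); last by ring.
by rewrite (mulrC _ 12^-1).
Qed.

Lemma H1semi_eq0 u : Usharp N u -> H1semi N u = 0 -> u = (fun _ => 0).
Proof.
move=> us h0; apply: funext => i; apply/eqP; rewrite -sqrf_eq0 eq_le sqr_ge0.
by rewrite (le_trans (poincare_pointwise u us i)) // h0 expr0n mul0r.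
Qed.

Lemma H1semi_gt0 u : Usharp N u -> u <> (fun _ => 0) -> 0 < H1semi N u.
Proof.
move=> us u0; rewrite lt_def H1semi_ge0 andbT; apply/eqP => h.
exact/u0/H1semi_eq0.
Qed.

Lemma UsharpN u : Usharp N u -> Usharp N (fun i => - u i).
Proof.
move=> [uper u0]; split=> [i|]; first by rewrite uper.
by rewrite /meanX sumrN mulrN -/(meanX N u) u0 oppr0.
Qed.

Lemma Dop_opp u : Dop N (fun i => - u i) = (fun i => - Dop N u i).
Proof. by apply: funext => i; rewrite /Dop -mulNr opprB opprK addrC. Qed.

Lemma H1semiN u : H1semi N (fun i => - u i) = H1semi N u.
Proof.
congr Num.sqrt; rewrite /dotX Dop_opp; congr (_ * _).
by apply: eq_bigr => i _; rewrite mulrNN.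
Qed.

Lemma dotXNr f u : dotX N f (fun i => - u i) = - dotX N f u.
Proof.
by rewrite /dotX -mulrN -sumrN; congr (_ * _); apply: eq_bigr => i _; rewrite mulrN.
Qed.

Lemma dotX_le_Hm1 f v : Usharp N v -> dotX N f v <= Hm1semi N f * H1semi N v.
Proof.
move=> vs; have [v0|v0] := pselect (v = fun _ => 0).
  rewrite {1}v0 /dotX big1 ?mulr0; last by move=> i _; rewrite mulr0.
  have -> : H1semi N v = 0; last by rewrite mulr0.
  rewrite /H1semi /L2norm /dotX big1 ?mulr0 ?sqrtr0 // => i _.
  by rewrite v0 /Dop subrr mul0r mulr0.
rewrite -ler_pdivrMr ?H1semi_gt0 //; apply: ub_le_sup; last by exists v.
(* A supremum bounds its set only if the set is bounded above; Cauchy-Schwarz and Poincare provide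
   the bound. *)
exists (L2norm N f * (2 * Num.sqrt 3)^-1) => _ [w [ws w0 ->]].
rewrite ler_pdivrMr ?H1semi_gt0 // (le_trans (dotX_cauchy_schwarz f w)) // -mulrA.
by rewrite ler_wpM2l ?sqrtr_ge0 ?poincare.
Qed.

(** Testing with [v] and [- v] rules out a negative supremum. If there is no nonzero test function,
    as for [N = 1], the set is empty and its [sup] is 0 by convention. *)
Lemma Hm1semi_ge0 f : 0 <= Hm1semi N f.
Proof.
have [[v [vs v0]]|none] := pselect (exists v, Usharp N v /\ v <> (fun _ => 0)).
  have vp := H1semi_gt0 _ vs v0.
  have := dotX_le_Hm1 f _ vs; have := dotX_le_Hm1 f _ (UsharpN _ vs).
  by rewrite H1semiN dotXNr; nra.
rewrite /Hm1semi (_ : [set _ | _]%classic = set0) ?sup0 //.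
by apply/seteqP; split=> // x [w [ws w0 _]]; case: none; exists w.
Qed.

End Norms.

(** * Slopes, element means and the indices of the mesh *)

Definition slope {R : realType} (N : nat) (idx : nat -> nat) (k : nat)
    (v : int -> R) : R :=
  (v (idx k.+1)%:Z - v (idx k)%:Z) / Hk N idx k.

Definition element_mean {R : realType} (idx : nat -> nat) (k : nat)
    (g : int -> R) : R :=
  (idx k.+1 - idx k)%:R^-1 * \sum_(idx k <= i < idx k.+1) g i%:Z.

Section MeshIndices.
Context {N p K : nat} {idx rep coll : nat -> nat}.
Context (p0 : (0 < p)%N) (mesh : hqc_mesh N p K idx rep coll).

(** Each element, the last one included, contains a sampling domain of [p > 0] points. *)
Lemma idx_lt k : (1 <= k <= K)%N -> (idx k < idx k.+1)%N.
Proof. by move=> kK; have [_ /(_ _ kK)[]] := mesh; lia. Qed.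

Lemma idx_le k m : (1 <= k)%N -> (k <= m)%N -> (m <= K.+1)%N ->
  (idx k <= idx m)%N.
Proof.
move=> k1; elim: m => [|m IH] km mK; first by lia.
have [<-//|neq] := eqVneq k m.+1.
by have := idx_lt m; lia.
Qed.

Lemma element_range k (i : nat) : (1 <= k <= K)%N -> (idx k <= i < idx k.+1)%N ->
  (1 <= i <= N)%N.
Proof.
move=> kK iS; have [[K0 i1 _ _ iK] _] := mesh.
by have := idx_le 1 k; have := idx_le k.+1 K.+1; lia.
Qed.

Lemma sum_elements {V : zmodType} (F : nat -> V) :
  \sum_(1 <= i < N.+1) F i
    = \sum_(1 <= k < K.+1) \sum_(idx k <= i < idx k.+1) F i.
Proof.
have [[K0 i1 _ _ iK] _] := mesh.
suff H m : (m <= K)%N -> \sum_(1 <= i < idx m.+1) F i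
    = \sum_(1 <= k < m.+1) \sum_(idx k <= i < idx k.+1) F i.
  by rewrite -iK H.
elim: m => [|m IH] mK; first by rewrite i1 !big_geq.
have l1 : (1 <= idx m.+1)%N by rewrite -[leqLHS]i1 idx_le //; lia.
have l2 : (idx m.+1 <= idx m.+2)%N by rewrite idx_le //; lia.
by rewrite (big_cat_nat l1 l2) /= IH 1?ltnW // [RHS]big_nat_recr.
Qed.

End MeshIndices.

(** * Piecewise affine functions as sums over elements *)

Section Mesh.
Context {R : realType} {N p K : nat} {idx rep coll : nat -> nat}.
Context (N0 : (0 < N)%N) (p0 : (0 < p)%N) (mesh : hqc_mesh N p K idx rep coll).
Implicit Types (u v f : int -> R) (k : nat).

Let NR0 : (N%:R : R) != 0. Proof. by rewrite pnatr_eq0 -lt0n. Qed.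

Lemma eps_gt0 : 0 < (eps N : R).
Proof. by rewrite /eps invr_gt0 ltr0n. Qed.

Let eps0 : (eps N : R) != 0. Proof. by rewrite gt_eqF // eps_gt0. Qed.

Lemma Hk_gt0 k : (1 <= k <= K)%N -> 0 < (Hk N idx k : R).
Proof.
by move=> /(idx_lt p0 mesh) ik; rewrite mulr_gt0 ?eps_gt0 // ltr0n subn_gt0.
Qed.

Lemma Hk_ge0 k : 0 <= (Hk N idx k : R).
Proof. by rewrite mulr_ge0 ?ler0n // ltW // eps_gt0. Qed.

Lemma Hk_le_Hmax k : (1 <= k <= K)%N -> (Hk N idx k : R) <= Hmax N K idx.
Proof. by move=> kK; apply: le_bigmax_seq; rewrite ?mem_index_iota. Qed.

(** Functions of the space are affine up to the closing index [idx k.+1], which covers the forward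
    difference at the last point of the element. *)
Lemma Dop_UH v k (i : nat) : UHper N K idx v -> (1 <= k <= K)%N ->
  (idx k <= i < idx k.+1)%N -> Dop N v i = slope N idx k v.
Proof.
move=> [_ aff] kK iS; have [a [b vE]] := aff k kK.
have H0 := Hk_gt0 k kK; have ik := idx_lt p0 mesh k kK.
rewrite /slope /Dop -intS !vE; [|lia..].
have Hn0 : (Hk N idx k : R) != 0 by rewrite gt_eqF.
apply/eqP; rewrite eqr_div //; apply/eqP.
rewrite /Hk natrB ?(ltnW ik) // /Xpt intS !intrD -!pmulrn; ring.
Qed.

Lemma Dop_ell v k (i : int) : (1 <= k <= K)%N ->
  Dop N (ell N idx k v) i = slope N idx k v.
Proof.
by move=> kK; rewrite /Dop /ell -/(slope N idx k v) /Xpt !intrD; field.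
Qed.

(** Both slopes are constant on an element, so [g] enters only through its mean there; the number of
    points times [1 / N] is the element size. *)
Lemma dotX_elements (g u v : int -> R) : UHper N K idx u -> UHper N K idx v ->
  dotX N (fun i => g i * Dop N u i) (Dop N v)
  = \sum_(1 <= k < K.+1) Hk N idx k *
      (element_mean idx k g * slope N idx k u * slope N idx k v).
Proof.
move=> uH vH; rewrite /dotX (sum_elements p0 mesh) mulr_sumr.
apply: eq_big_nat => k /andP[k1 kK].
have kK' : (1 <= k <= K)%N by rewrite k1.
rewrite (eq_big_nat _ _
    (F2 := fun i => g i%:Z * (slope N idx k u * slope N idx k v))); last first.
  by move=> i iS; rewrite !(Dop_UH _ k) // mulrA.
rewrite -mulr_suml /Hk /element_mean /eps.
have : ((idx k.+1 - idx k)%:R : R) != 0.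
  by rewrite pnatr_eq0 -lt0n subn_gt0 (idx_lt p0 mesh).
by move=> ?; field; apply/andP.
Qed.

Lemma H1semi_elements u : UHper N K idx u ->
  H1semi N u ^+ 2 = \sum_(1 <= k < K.+1) Hk N idx k * slope N idx k u ^+ 2.
Proof.
move=> uH; rewrite H1semi_sqr.
rewrite -[LHS](_ : dotX N (fun i => 1 * Dop N u i) (Dop N u) = _); last first.
  by rewrite /dotX; under eq_bigr do rewrite mul1r.
rewrite dotX_elements //; apply: eq_big_nat => k kK.
rewrite /element_mean sumr_const_nat mulVf ?mul1r //.
by rewrite pnatr_eq0 -lt0n subn_gt0 (idx_lt p0 mesh).
Qed.

(** * The cell problem and the homogenized coefficient *)

Section Coefficient.
Context {psi : int -> int -> R} {cpsi Cpsi : R}.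
Context (per : two_scale N p psi) (a1 : A1 cpsi Cpsi psi).

Let pR0 : (p%:R : R) != 0. Proof. by rewrite pnatr_eq0 -lt0n. Qed.

Lemma cpsi_gt0 : 0 < cpsi. Proof. by have [] := a1. Qed.

Lemma psi_gt0 i j : 0 < psi i j.
Proof. by have [c0 /(_ i j)/andP[+ _]] := a1; apply: lt_le_trans. Qed.

Lemma Cpsi_gt0 : 0 < Cpsi.
Proof.
by have [_ /(_ 0 0)/andP[_ +]] := a1; apply: lt_le_trans; exact: psi_gt0.
Qed.

Lemma mean_inv_bounds (i : int) :
  Cpsi^-1 <= (p%:R)^-1 * \sum_(1 <= j < p.+1) (psi i j%:Z)^-1 <= cpsi^-1.
Proof.
have pp : 0 < (p%:R : R) by rewrite ltr0n.
have [c0 b] := a1.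
rewrite ler_pdivlMl // ler_pdivrMl //.
have cst (x : R) : p%:R * x = \sum_(1 <= j < p.+1) x.
  by rewrite sumr_const_nat subSS subn0 mulr_natl.
rewrite !cst; apply/andP; split; apply: ler_sum => j _;
  by rewrite lef_pV2 ?posrE ?psi_gt0 ?Cpsi_gt0 //; case/andP: (b i j%:Z).
Qed.

Lemma psi0_bounds (i : int) : cpsi <= psi0 p psi i <= Cpsi.
Proof.
have /andP[lo hi] := mean_inv_bounds i.
have c0 := cpsi_gt0; have C0 := Cpsi_gt0.
have m0 : 0 < (p%:R)^-1 * \sum_(1 <= j < p.+1) (psi i j%:Z)^-1.
  by apply: lt_le_trans lo; rewrite invr_gt0.
by rewrite /psi0 -[cpsi]invrK -[Cpsi]invrK !lef_pV2 ?posrE ?invr_gt0 // hi lo.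
Qed.

(** By periodicity the window may start anywhere, in particular at [rep k]. *)
Lemma sum_inv_psi (i a : int) :
  \sum_(m < p) (psi i (a + m%:Z))^-1 = p%:R / psi0 p psi i.
Proof.
rewrite /psi0 invrK mulrA mulfV // mul1r.
rewrite (sum_nat1_shift p (fun j => (psi i j)^-1)).
by apply: (sum_period p (fun j => (psi i j)^-1)) => j; rewrite (per i j).2.
Qed.

Lemma psi0_gt0 i : 0 < psi0 p psi i.
Proof. by have /andP[+ _] := psi0_bounds i; apply: lt_le_trans; exact: cpsi_gt0. Qed.

(* On a cell the flux [psi D r] of the reconstruction is constant; the value of
   the constant is forced by the mean of [D r] being the macroscopic slope. *)
Lemma cell_solution k v : (1 <= k <= K)%N -> exists w : int -> R,
  Upsharp p w /\ forall i, Dop N (fun j => ell N idx k v j + w j) i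
    = psi0 p psi (coll k)%:Z * slope N idx k v / psi (coll k)%:Z i.
Proof.
move=> kK; set s := slope N idx k v; set a := psi0 p psi (coll k)%:Z.
(* Increment required of the corrector. Its sum over a period vanishes precisely because [a] is the
   harmonic mean of [psi] at the collocation point. *)
pose g i : R := eps N * (a * s / psi (coll k)%:Z i - s).
have gper i : g (i + p%:Z) = g i by rewrite /g (per _ i).2.
have gsum : \sum_(m < p) g (0 + m%:Z) = 0.
  rewrite /g -mulr_sumr sumrB -mulr_sumr sum_inv_psi -/a sumr_const card_ord.
  by rewrite -mulr_natl; field; rewrite gt_eqF // psi0_gt0.
exists (primitive p g); split.
  split; first exact: primitive_per.
  by rewrite sum_nat1_shift primitive_sum.
move=> i; have := Dop_ell v k i kK; rewrite /Dop -/s => <-.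
rewrite -{1}[ell _ _ _ _ (i + 1)]addr0.
have := primitive_diff p g p0 gper gsum i.
move=> /(canRL (subrK _)) ->; rewrite /g.
have -> : s = (ell N idx k v (i + 1) - ell N idx k v i) / eps N.
  by rewrite -/(Dop N _ i) Dop_ell.
by field; rewrite gt_eqF ?psi_gt0.
Qed.

(** The sum telescopes over a period. This is why a constant flux solves the cell problem. *)
Lemma dotrep_cst_Dop k (c : R) s : Upsharp p s ->
  dotrep p rep k (fun=> c) (Dop N s) = 0.
Proof.
move=> [sper _]; rewrite /dotrep -mulr_sumr.
rewrite (sum_nat_shift p (rep k) (Dop N s)) /Dop -mulr_suml sum_telescope.
by rewrite sper subrr mul0r !mulr0.
Qed.

(** The value picked by [epsilon] is meaningful only once some reconstruction exists;
    [cell_solution] supplies one. *)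
Lemma recon_exists k v : (1 <= k <= K)%N ->
  is_recon N p idx rep coll psi k v (Recon N p idx rep coll psi k v).
Proof.
move=> kK; apply: epsilon_spec.
have [w [ws wD]] := cell_solution k v kK.
exists (fun i => ell N idx k v i + w i), w; split=> // s ss.
rewrite -[RHS](dotrep_cst_Dop k (psi0 p psi (coll k)%:Z * slope N idx k v) s ss).
rewrite /dotrep; congr (_ * _); apply: eq_bigr => i _; congr (_ * _).
by rewrite wD mulrC /psi_coll divfK // gt_eqF // psi_gt0.
Qed.

(** Uniqueness for the cell problem, at the level of differences: it applies to whichever
    reconstruction [epsilon] picks. *)
Lemma recon_Dop k v r : (1 <= k <= K)%N -> is_recon N p idx rep coll psi k v r ->
  forall i : nat, (rep k <= i < rep k + p)%N ->
  Dop N r i = psi0 p psi (coll k)%:Z * slope N idx k v / psi (coll k)%:Z i.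
Proof.
move=> kK [w [ws -> orth]].
have [w0 [w0s w0D]] := cell_solution k v kK.
pose s i := w i - w0 i.
have ss : Upsharp p s.
  case: ws w0s => [wper wsum] [w0per w0sum]; split=> [i|].
    by rewrite /s wper w0per.
  by rewrite /s sumrB wsum w0sum subrr.
have DE i : Dop N (fun j => ell N idx k v j + w j) i
    = psi0 p psi (coll k)%:Z * slope N idx k v / psi (coll k)%:Z i + Dop N s i.
  by rewrite -w0D /Dop /s; field.
(* The test function is the difference [s] of the two correctors; removing the constant flux, which
   pairs to zero with [Dop N s], leaves a sum of nonnegative terms. *)
have z : \sum_(rep k <= i < rep k + p) psi (coll k)%:Z i%:Z * Dop N s i%:Z ^+ 2 = 0.
  have := orth s ss.
  rewrite -[in LHS](subr0 (dotrep _ _ _ _ _)).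
  rewrite -[X in _ - X](dotrep_cst_Dop k (psi0 p psi (coll k)%:Z * slope N idx k v) s ss).
  rewrite /dotrep -mulrBr -sumrB => /eqP.
  rewrite mulf_eq0 invr_eq0 (negPf pR0) /= => /eqP; apply: etrans.
  apply: eq_bigr => i _; rewrite DE /psi_coll.
  by field; rewrite gt_eqF // psi_gt0.
move=> i ir; rewrite DE; move/eqP: z; rewrite psumr_eq0; last first.
  by move=> j _; rewrite mulr_ge0 ?sqr_ge0 // ltW // psi_gt0.
move/allP => /(_ i); rewrite mem_index_iota => /(_ ir) /=.
by rewrite mulf_eq0 gt_eqF ?psi_gt0 //= sqrf_eq0 => /eqP ->; rewrite addr0.
Qed.

(** The flux of [u] is [a] times its slope, the difference of the reconstruction of [v] is [a] times
    its slope over [psi], and [1 / psi] has mean [1 / a]. *)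
Lemma dotrep_recon k u v : (1 <= k <= K)%N ->
  dotrep p rep k
    (fun i => psi_coll psi coll k i * Dop N (Recon N p idx rep coll psi k u) i)
    (Dop N (Recon N p idx rep coll psi k v))
  = psi0 p psi (coll k)%:Z * slope N idx k u * slope N idx k v.
Proof.
move=> kK; set a := psi0 p psi (coll k)%:Z.
rewrite /dotrep (eq_big_nat _ _ (F2 := fun i =>
    a ^+ 2 * slope N idx k u * slope N idx k v * (psi (coll k)%:Z i%:Z)^-1)).
  rewrite -mulr_sumr (sum_nat_shift p (rep k) (fun i => (psi (coll k)%:Z i)^-1)).
  rewrite sum_inv_psi -/a; field.
  by rewrite gt_eqF ?psi0_gt0.
move=> i ir; rewrite !(recon_Dop _ _ _ kK (recon_exists k _ kK)) //.
by rewrite /psi_coll -/a; field; rewrite gt_eqF // psi_gt0.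
Qed.

End Coefficient.
End Mesh.

(** * Discrete Lipschitz and Taylor estimates *)

Section DiscreteTaylor.
Context {F : realFieldType}.
Implicit Types (h : nat -> F) (n : nat) (b : F).

Lemma lipschitz_iter n h b : (forall j, (j < n)%N -> `|h j.+1 - h j| <= b) ->
  0 <= b -> forall i j, (i <= n)%N -> (j <= n)%N -> `|h i - h j| <= n%:R * b.
Proof.
move=> hb b0 i j.
have up k m : (m + k <= n)%N -> `|h (m + k)%N - h m| <= k%:R * b.
  elim: k => [|k IH] kn; first by rewrite addn0 subrr normr0 mul0r.
  rewrite addnS -(subrK (h (m + k)%N) (h _)) -addrA -natr1 mulrDl mul1r addrC.
  by rewrite (le_trans (ler_normD _ _)) // lerD ?IH ?hb //; lia.
wlog ij : i j / (j <= i)%N => [W|] i_n j_n.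
  by case/orP: (leq_total j i) => ij; [|rewrite distrC]; apply: W.
rewrite -(subnKC ij) (le_trans (up _ _ _)) ?subnKC //.
by rewrite ler_wpM2r // ler_nat; lia.
Qed.

(** Summing second differences once compares each first difference with the initial one; summing
    again bounds the remainder. The crude [n ^+ 2] replaces [j * (j - 1) / 2]. *)
Lemma taylor_iter n h b :
  (forall j, (j.+1 < n)%N -> `|h j.+2 - h j.+1 - (h j.+1 - h j)| <= b) ->
  0 <= b -> forall j, (j < n)%N ->
  `|h j - h 0%N - j%:R * (h 1%N - h 0%N)| <= n%:R ^+ 2 * b.
Proof.
move=> hb b0 j jn; pose d := h 1%N - h 0%N.
have first m : (m < n)%N -> `|h m.+1 - h m - d| <= m%:R * b.
  elim: m => [|m IH] mn; first by rewrite /d subrr normr0 mul0r.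
  rewrite -(subrKA (h m.+1 - h m)) -natr1 mulrDl mul1r addrC.
  by rewrite (le_trans (ler_normD _ _)) // lerD ?IH ?hb //; lia.
have snd m : (m < n)%N -> `|h m - h 0%N - m%:R * d| <= m%:R * n%:R * b.
  elim: m => [|m IH] mn; first by rewrite subrr !mul0r subr0 normr0.
  rewrite (_ : h m.+1 - _ - _
    = (h m - h 0%N - m%:R * d) + (h m.+1 - h m - d)); last first.
    by rewrite -natr1; ring.
  rewrite -natr1 !mulrDl mul1r (le_trans (ler_normD _ _)) // lerD ?IH //; first lia.
  rewrite (le_trans (first m _)) ?ler_wpM2r // ?ler_nat; lia.
rewrite (le_trans (snd j jn)) // expr2 ler_wpM2r // ler_wpM2r // ler_nat; lia.
Qed.

End DiscreteTaylor.

Lemma sum_natr {F : numFieldType} (n : nat) :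
  \sum_(m < n) (m%:R : F) = n%:R * (n%:R - 1) / 2.
Proof.
elim: n => [|n IH]; first by rewrite big_ord0; field.
by rewrite big_ord_recr /= IH -natr1; field.
Qed.

(** * Consistency of the coefficients and the resulting error bounds *)

Section ModelingError.
Context {R : realType} {N p K : nat} {idx rep coll : nat -> nat}.
Context {psi : int -> int -> R} {cpsi Cpsi Cpsi' : R} {f uH ut : int -> R}.
Context (N0 : (0 < N)%N) (p0 : (0 < p)%N) (mesh : hqc_mesh N p K idx rep coll).
Context (per : two_scale N p psi) (a1 : A1 cpsi Cpsi psi).
Context (a2 : A2 N p Cpsi' psi).

Let nelt k := (idx k.+1 - idx k)%N.

Lemma nelt_neq0 k : (1 <= k <= K)%N -> ((nelt k)%:R : R) != 0.
Proof. by move=> kK; rewrite pnatr_eq0 -lt0n subn_gt0 (idx_lt p0 mesh). Qed.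

Lemma element_meanE k (g : int -> R) : (1 <= k <= K)%N ->
  element_mean idx k g
  = (nelt k)%:R^-1 * \sum_(m < nelt k) g ((idx k)%:Z + m%:Z).
Proof.
move=> kK; rewrite /element_mean -sum_nat_shift /nelt subnKC //.
by rewrite ltnW // (idx_lt p0 mesh).
Qed.

Lemma element_mean_cst k (c : R) : (1 <= k <= K)%N ->
  element_mean idx k (fun=> c) = c.
Proof.
move=> kK; rewrite element_meanE // sumr_const card_ord -[c *+ _]mulr_natl mulKf //.
exact: nelt_neq0.
Qed.

Lemma element_mean_ge k (g : int -> R) (c : R) : (1 <= k <= K)%N ->
  (forall i, c <= g i) -> c <= element_mean idx k g.
Proof.
move=> kK cg; rewrite -[c](element_mean_cst k) // ler_wpM2l ?invr_ge0 ?ler0n //.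
by apply: ler_sum => i _.
Qed.

Lemma element_mean_dist k (g : int -> R) (c d : R) : (1 <= k <= K)%N ->
  (forall m, (m < nelt k)%N -> `|g ((idx k)%:Z + m%:Z) - c| <= d) ->
  `|element_mean idx k g - c| <= d.
Proof.
move=> kK gd; have n0 := nelt_neq0 k kK.
have np : 0 < ((nelt k)%:R : R) by rewrite lt_def n0 ler0n.
rewrite -[X in _ - X](element_mean_cst k) // !element_meanE // -mulrBr -sumrB.
rewrite normrM gtr0_norm ?invr_gt0 // ler_pdivrMl //.
rewrite (le_trans (ler_norm_sum _ _ _)) // mulr_natl.
have -> : d *+ nelt k = \sum_(m < nelt k) d by rewrite sumr_const card_ord.
by apply: ler_sum => m _; apply: gd.
Qed.

Lemma UHsharp_Usharp (v : int -> R) : UHsharp N K idx v -> Usharp N v.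
Proof. by case=> [[vper _] v0]; split. Qed.

Lemma emod_sharp : UHsharp N K idx uH -> UHsharp N K idx ut ->
  UHsharp N K idx (emod uH ut).
Proof.
rewrite /emod => -[[uper uaff] u0] [[tper taff] t0]; split; first split.
- by move=> i; rewrite uper tper.
- move=> k kK; have [a [b uE]] := uaff k kK; have [a' [b' tE]] := taff k kK.
  exists (a - a'), (b - b') => i iS; rewrite uE // tE //; ring.
by rewrite /meanX sumrB mulrBr -/(meanX N uH) -/(meanX N ut) u0 t0 subrr.
Qed.

Lemma slope_emod k : slope N idx k (emod uH ut) = slope N idx k uH - slope N idx k ut.
Proof. by rewrite /slope /emod; ring. Qed.

(* Both methods become weighted sums of products of slopes, with coefficients
   [psi0] at the collocation point and the element mean of [psi0]; testing the
   difference with the error itself is a first Strang lemma. *)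
Lemma modeling_error_le (d : R) :
  HQC_sol N p K idx rep coll psi f uH -> hom_sol N p K idx psi f ut ->
  (forall k, (1 <= k <= K)%N ->
     `|element_mean idx k (psi0 p psi) - psi0 p psi (coll k)%:Z| <= d) ->
  H1semi N (emod uH ut) <= d / cpsi ^+ 2 * Hm1semi N f.
Proof.
move=> [uHs hqc] [uts hom] dist.
have es := emod_sharp uHs uts.
have c0 := cpsi_gt0 a1; have F0 := Hm1semi_ge0 N0 f.
have K0 : (0 < K)%N by have [[]] := mesh.
(* The bound [d] dominates a norm because there is at least one element. *)
have d0 : 0 <= d by apply: le_trans (dist 1%N _); rewrite ?K0.
set e := emod uH ut in es *.
set A := fun k => element_mean idx k (psi0 p psi) in dist.
set a := fun k => psi0 p psi (coll k)%:Z in dist.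
pose s k (v : int -> R) := slope N idx k v.
have psi0_ge i : cpsi <= psi0 p psi i by case/andP: (psi0_bounds p0 a1 i).
have homE (v : int -> R) : UHsharp N K idx v -> dotX N f v
    = \sum_(1 <= k < K.+1) Hk N idx k * (A k * s k ut * s k v).
  move=> vs; rewrite -hom // (dotX_elements N0 p0 mesh) //.
    by case: uts.
  by case: vs.
have hqcE (v : int -> R) : UHsharp N K idx v -> dotX N f v
    = \sum_(1 <= k < K.+1) Hk N idx k * (a k * s k uH * s k v).
  move=> vs; rewrite -hqc //; apply: eq_big_nat => k kK.
  by rewrite (dotrep_recon N0 p0 per a1 k _ _ kK).
have semi (v : int -> R) : UHsharp N K idx v -> H1semi N v ^+ 2
    = \sum_(1 <= k < K.+1) Hk N idx k * s k v ^+ 2.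
  by move=> [vH _]; rewrite (H1semi_elements N0 p0 mesh).
have H0 k : 0 <= (Hk N idx k : R) by exact: (Hk_ge0 N0).
(* A priori bound: the homogenized problem tested with its own solution. *)
have stab : cpsi * H1semi N ut ^+ 2 <= Hm1semi N f * H1semi N ut.
  rewrite (le_trans _ (dotX_le_Hm1 N0 f ut _)) //; last exact: UHsharp_Usharp.
  rewrite homE // semi // mulr_sumr; apply: ler_sum_nat => k kK.
  rewrite mulrCA ler_wpM2l // -mulrA -expr2 ler_wpM2r ?sqr_ge0 //.
  exact: element_mean_ge.
have cons : cpsi * H1semi N e ^+ 2 <= d * (H1semi N ut * H1semi N e).
  have cs : \sum_(1 <= k < K.+1) Hk N idx k * (`|s k ut| * `|s k e|)
      <= H1semi N ut * H1semi N e.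
    rewrite -ler_sqr ?nnegrE ?mulr_ge0 ?H1semi_ge0 //; last first.
      by apply: sumr_ge0 => k _; rewrite mulr_ge0 // mulr_ge0.
    rewrite (le_trans (wsum_cauchy_schwarz _ _ _ _ H0)) // exprMn !semi //.
    by rewrite le_eqVlt; apply: predU1l; congr (_ * _); apply: eq_bigr => k _;
      rewrite ?real_normK ?num_real.
  apply: le_trans (ler_wpM2l d0 cs).
  apply: (@le_trans _ _ (\sum_(1 <= k < K.+1) Hk N idx k * (a k * s k e * s k e))).
    rewrite semi // mulr_sumr; apply: ler_sum_nat => k kK.
    rewrite mulrCA ler_wpM2l // -mulrA -expr2 ler_wpM2r ?sqr_ge0 //.
    exact: psi0_ge.
  (* Both problems tested with [e] have the same right-hand side; equating them moves the
     coefficient gap onto [ut]. *)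
  have -> : \sum_(1 <= k < K.+1) Hk N idx k * (a k * s k e * s k e)
      = \sum_(1 <= k < K.+1) Hk N idx k * ((A k - a k) * (s k ut * s k e)).
    apply/eqP; rewrite -subr_eq0 -sumrB; apply/eqP.
    have := homE e es; rewrite (hqcE e es) => /eqP.
    rewrite -subr_eq0 -sumrB => /eqP; apply: etrans; apply: eq_bigr => k _.
    by rewrite /s /e slope_emod; ring.
  rewrite mulr_sumr; apply: ler_sum_nat => k kK.
  rewrite [leRHS]mulrCA ler_wpM2l // (le_trans (ler_norm _)) // !normrM.
  by rewrite ler_wpM2r ?mulr_ge0 // dist.
have E0 := H1semi_ge0 e (N := N); have U0 := H1semi_ge0 ut (N := N).
move: cons stab E0 U0.
move: (H1semi N e) (H1semi N ut) (Hm1semi N f) F0 => E U F F0 cons stab E0 U0.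
(* One factor [E], and below one factor [U], is cancelled; the zero case is separate. *)
have EU : cpsi * E <= d * U.
  have [->|En] := eqVneq E 0; first by rewrite mulr0 mulr_ge0.
  by rewrite -(@ler_pM2r _ E) ?lt_def ?En // -!mulrA -expr2.
have UF : cpsi * U <= F.
  have [->|Un] := eqVneq U 0; first by rewrite mulr0.
  by rewrite -(@ler_pM2r _ U) ?lt_def ?Un // -!mulrA -expr2.
rewrite mulrAC ler_pdivlMr ?exprn_gt0 //.
rewrite (_ : E * _ = cpsi * (cpsi * E)); last by ring.
rewrite (le_trans (ler_wpM2l (ltW c0) EU)) // mulrCA ler_wpM2l //.
Qed.

Lemma psi_lipschitz (i j : nat) : (1 <= i <= N)%N -> (1 <= j <= p)%N ->
  `|psi (i%:Z + 1) j%:Z - psi i%:Z j%:Z| <= Cpsi' * eps N.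
Proof.
move=> iN jp; rewrite -ler_pdivrMr ?eps_gt0 //.
rewrite -[X in _ / X](gtr0_norm (eps_gt0 N0)) -normf_div.
apply: le_trans a2; rewrite /Linf2.
apply: le_trans (le_bigmax_seq _ i _ _ _ _); rewrite ?mem_index_iota //.
by apply: (le_bigmax_seq _ j); rewrite ?mem_index_iota.
Qed.

Lemma Cpsi'_ge0 : 0 <= Cpsi'.
Proof. by apply: le_trans a2; apply: bigmax_ge_id. Qed.

(** Two inversions occur in [psi0]: that of [psi >= cpsi] costs [cpsi ^- 2], and that of the mean of
    inverses, at least [1 / Cpsi], costs [Cpsi ^+ 2]. *)
Definition psi0_lip_const : R := Cpsi ^+ 2 * Cpsi' / cpsi ^+ 2.

Lemma psi0_lip_const_ge0 : 0 <= psi0_lip_const.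
Proof. by rewrite divr_ge0 ?sqr_ge0 // mulr_ge0 ?sqr_ge0 ?Cpsi'_ge0. Qed.

Lemma psi0_lipschitz (i : nat) : (1 <= i <= N)%N ->
  `|psi0 p psi (i%:Z + 1) - psi0 p psi i%:Z| <= psi0_lip_const * eps N.
Proof.
move=> iN; have c0 := cpsi_gt0 a1; have C0 := Cpsi_gt0 a1.
have inv_dist (c x y : R) : 0 < c -> c <= x -> c <= y ->
    `|x^-1 - y^-1| <= `|x - y| / c ^+ 2.
  move=> cp cx cy; have x0 := lt_le_trans cp cx; have y0 := lt_le_trans cp cy.
  have -> : x^-1 - y^-1 = (y - x) / (x * y) by field; rewrite !gt_eqF.
  rewrite normrM distrC normfV (gtr0_norm (mulr_gt0 x0 y0)) ler_wpM2l //.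
  by rewrite lef_pV2 ?posrE ?mulr_gt0 ?exprn_gt0 // expr2 ler_pM // ltW.
have pp : 0 < (p%:R : R) by rewrite ltr0n.
rewrite /psi0; have /andP[lx _] := mean_inv_bounds p0 a1 (i%:Z + 1).
have /andP[ly _] := mean_inv_bounds p0 a1 i%:Z.
have C1 : 0 < Cpsi^-1 by rewrite invr_gt0.
rewrite (le_trans (inv_dist _ _ _ C1 lx ly)) //.
rewrite exprVn invrK mulrC -[leRHS]mulrA -mulrA ler_wpM2l ?sqr_ge0 //.
rewrite -mulrBr -sumrB normrM gtr0_norm ?invr_gt0 // ler_pdivrMl //.
rewrite (le_trans (ler_norm_sum _ _ _)) //.
have -> : p%:R * (Cpsi' * (cpsi ^- 2 * eps N))
    = \sum_(1 <= j < p.+1) (Cpsi' * eps N / cpsi ^+ 2).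
  by rewrite sumr_const_nat subSS subn0 -mulr_natl; ring.
apply: ler_sum_nat => j jp.
have lo i' : cpsi <= psi i' j%:Z by case: a1 => _ /(_ i' j%:Z)/andP[].
rewrite (le_trans (inv_dist _ _ _ c0 _ _)) // ler_wpM2r ?invr_ge0 ?sqr_ge0 //.
exact: psi_lipschitz.
Qed.

Lemma coll_offset k : (1 <= k <= K)%N ->
  exists2 m, (m < nelt k)%N & coll k = (idx k + m)%N.
Proof.
move=> kK; have [_ /(_ k kK)[? ? ?]] := mesh.
by exists (coll k - idx k)%N; rewrite /nelt; lia.
Qed.

Lemma HkE k : (Hk N idx k : R) = (nelt k)%:R * eps N.
Proof. by rewrite /Hk mulrC. Qed.

(** Only the left point has to lie in the element; the right one may be [idx k.+1]. *)
Lemma psi0_lipschitz_offset k (j : nat) : (1 <= k <= K)%N -> (j < nelt k)%N ->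
  `|psi0 p psi ((idx k)%:Z + j.+1%:Z) - psi0 p psi ((idx k)%:Z + j%:Z)|
    <= psi0_lip_const * eps N.
Proof.
move=> kK jn; rewrite intS addrA -PoszD psi0_lipschitz //.
by apply: (element_range p0 mesh _ _ kK); move: jn; rewrite /nelt; lia.
Qed.

(** The collocation point and any point of the element are at most [nelt k] grid steps apart, and
    these steps add up to the element size. *)
Lemma element_mean_coll_H k : (1 <= k <= K)%N ->
  `|element_mean idx k (psi0 p psi) - psi0 p psi (coll k)%:Z|
    <= psi0_lip_const * Hmax N K idx.
Proof.
move=> kK; have [c cn ->] := coll_offset k kK.
have L0 := psi0_lip_const_ge0; have e0 := ltW (eps_gt0 (R := R) N0).
have Le0 := mulr_ge0 L0 e0.
apply: (@le_trans _ _ (psi0_lip_const * Hk N idx k)); last first.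
  by rewrite ler_wpM2l // Hk_le_Hmax.
apply: element_mean_dist => // m mn; rewrite HkE mulrCA PoszD.
apply: (lipschitz_iter (nelt k) (fun j => psi0 p psi ((idx k)%:Z + j%:Z))) => //.
- by move=> j jn; apply: psi0_lipschitz_offset.
- exact: ltnW.
- exact: ltnW.
Qed.

(* The first order Taylor term survives only through the distance between the
   collocation index and the barycentre of the element. *)
Lemma element_mean_coll_H2 k (Ccoll C2 : R) : (1 <= k <= K)%N ->
  `|Xpt N (coll k)%:Z - (Xpt N (idx k)%:Z + Xpt N (idx k.+1).-1%:Z) / 2|
    <= eps N * Ccoll ->
  Linfnorm N (Dop N (Dop N (psi0 p psi))) <= C2 ->
  `|element_mean idx k (psi0 p psi) - psi0 p psi (coll k)%:Z|
    <= 2 * C2 * Hmax N K idx ^+ 2 + Ccoll * psi0_lip_const * eps N.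
Proof.
move=> kK; have [c cn ->] := coll_offset k kK.
have e0 := eps_gt0 (R := R) N0; have ik := idx_lt p0 mesh k kK.
have n0 := nelt_neq0 k kK.
have nE : (idx k.+1 = idx k + nelt k)%N by rewrite subnKC // ltnW.
have np : (0 < nelt k)%N by rewrite /nelt; lia.
have en0 : (eps N : R) != 0 by rewrite gt_eqF.
set n := nelt k in nE np n0 cn *.
(* The barycentre of the element has offset [(n - 1) / 2] from [idx k], so the hypothesis bounds the
   index distance by [Ccoll] after division by [eps N]. *)
have -> : Xpt N (idx k + c)%:Z - (Xpt N (idx k)%:Z + Xpt N (idx k.+1).-1%:Z) / 2
    = eps N * (c%:R - (n%:R - 1) / 2) :> R.
  have -> : (idx k.+1).-1%:Z = (idx k)%:Z + n%:Z - 1 by rewrite nE; lia.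
  by rewrite /Xpt PoszD !intrD mulrN1z -!pmulrn; field.
rewrite normrM gtr0_norm // ler_pM2l // => cdist D2.
have C20 : 0 <= C2 by apply: le_trans D2; apply: bigmax_ge_id.
pose h (j : nat) := psi0 p psi ((idx k)%:Z + j%:Z).
have second j : (j.+1 < n)%N -> `|h j.+2 - h j.+1 - (h j.+1 - h j)| <= C2 * eps N ^+ 2.
  move=> jn; have iN : (1 <= idx k + j <= N)%N.
    by apply: (element_range p0 mesh _ _ kK); lia.
  have := le_trans (le_bigmax_seq 0 (idx k + j)%N xpredT
    (fun i => `|Dop N (Dop N (psi0 p psi)) i%:Z|) _ isT) D2.
  rewrite mem_index_iota iN => /(_ isT).
  rewrite -ler_pdivrMr ?exprn_gt0 //; apply: le_trans.
  rewrite -[X in _ / X]gtr0_norm ?exprn_gt0 // -normf_div /h !intS !addrA -PoszD.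
  by rewrite le_eqVlt; apply: predU1l; congr `|_|; rewrite /Dop; field.
have b0 : 0 <= C2 * eps N ^+ 2 by rewrite mulr_ge0 ?sqr_ge0.
have tay := taylor_iter n h _ second b0.
set d := h 1%N - h 0%N in tay.
have db : `|d| <= psi0_lip_const * eps N by exact: (psi0_lipschitz_offset k 0).
have HE : n%:R ^+ 2 * (C2 * eps N ^+ 2) = C2 * Hk N idx k ^+ 2.
  by rewrite HkE -/n; ring.
rewrite HE in tay.
(* The Taylor remainder about the first point of the element, written on all integers so that its
   element mean makes sense. *)
pose g (i : int) : R := psi0 p psi i - h 0%N - (i%:~R - (idx k)%:R) * d.
have gE j : g ((idx k)%:Z + j%:Z) = h j - h 0%N - j%:R * d.
  by rewrite /g /h intrD -!pmulrn; ring.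
(* The linear term has mean [(n - 1) / 2 * d], with the same offset as the barycentre. *)
have mE : element_mean idx k (psi0 p psi)
    = element_mean idx k g + h 0%N + (n%:R - 1) / 2 * d.
  rewrite !element_meanE // -/n.
  under [in RHS]eq_bigr do rewrite gE.
  rewrite !sumrB -mulr_suml sum_natr sumr_const card_ord -[_ *+ n]mulr_natl.
  by rewrite -/n /h; field.
have -> : element_mean idx k (psi0 p psi) - psi0 p psi (idx k + c)%:Z
    = (element_mean idx k g - (h c - h 0%N - c%:R * d))
      - (c%:R - (n%:R - 1) / 2) * d.
  by rewrite mE PoszD -/(h c); ring.
rewrite (le_trans (ler_normB _ _)) // lerD //.
  (* Two remainders, at the running point and at the collocation point, give the factor 2. *)
  apply: element_mean_dist => // m mn; rewrite gE (le_trans (ler_normB _ _)) //.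
  rewrite (le_trans (lerD (tay m mn) (tay c cn))) // -mulr2n -[leLHS]mulr_natl -mulrA.
  rewrite ler_wpM2l // ler_wpM2l // ler_sqr ?nnegrE ?Hk_ge0 //.
    exact: Hk_le_Hmax.
  by apply: bigmax_ge_id.
by rewrite normrM -mulrA ler_pM.
Qed.

End ModelingError.

(** * Assembling the three estimates *)

Theorem theorem6p4 (R : realType) (p : nat) (cpsi Cpsi Cpsi' : R) :
  (0 < p)%N ->
  (* (a) *)
  (exists C10 : R,
     forall (N K : nat) (idx rep coll : nat -> nat) (psi : int -> int -> R)
            (f uH ut : int -> R),
       (0 < N)%N -> hqc_mesh N p K idx rep coll ->
       two_scale N p psi -> A1 cpsi Cpsi psi -> A2 N p Cpsi' psi ->
       Uper N f -> meanX N f = 0 ->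
       HQC_sol N p K idx rep coll psi f uH -> hom_sol N p K idx psi f ut ->
       L2norm N (emod uH ut) <= (2 * Num.sqrt 3)^-1 * H1semi N (emod uH ut) /\
       (2 * Num.sqrt 3)^-1 * H1semi N (emod uH ut)
         <= C10 * Hmax N K idx * Hm1semi N f)
  /\
  (* (b) *)
  (forall Ccoll Cpsi0'' : R,
   exists C11 C12 : R,
     forall (N K : nat) (idx rep coll : nat -> nat) (psi : int -> int -> R)
            (f uH ut : int -> R),
       (0 < N)%N -> hqc_mesh N p K idx rep coll ->
       two_scale N p psi -> A1 cpsi Cpsi psi -> A2 N p Cpsi' psi ->
       Uper N f -> meanX N f = 0 ->
       HQC_sol N p K idx rep coll psi f uH -> hom_sol N p K idx psi f ut ->
       (forall k, (1 <= k <= K)%N ->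
          `|Xpt N (coll k)%:Z
            - (Xpt N (idx k)%:Z + Xpt N (idx k.+1).-1%:Z) / 2| <= eps N * Ccoll) ->
       Linfnorm N (Dop N (Dop N (psi0 p psi))) <= Cpsi0'' ->
       L2norm N (emod uH ut) <= (2 * Num.sqrt 3)^-1 * H1semi N (emod uH ut) /\
       (2 * Num.sqrt 3)^-1 * H1semi N (emod uH ut)
         <= (C11 * Hmax N K idx ^+ 2 + C12 * eps N) * Hm1semi N f)
  /\
  (* (c) *)
  (forall (N K : nat) (idx rep coll : nat -> nat) (psi : int -> int -> R)
          (f uH ut : int -> R),
     (0 < N)%N -> hqc_mesh N p K idx rep coll ->
     two_scale N p psi -> A1 cpsi Cpsi psi -> A2 N p Cpsi' psi ->
     Uper N f -> meanX N f = 0 ->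
     HQC_sol N p K idx rep coll psi f uH -> hom_sol N p K idx psi f ut ->
     (forall i i' j, psi i j = psi i' j) ->
     emod uH ut = (fun _ => 0)).
Proof.
move=> p0; pose c3 : R := (2 * Num.sqrt 3)^-1.
have c30 : 0 <= c3 by rewrite invr_ge0 mulr_ge0 // sqrtr_ge0.
pose L := @psi0_lip_const R cpsi Cpsi Cpsi'.
have sharp N K idx (f uH ut : int -> R) rep coll psi :
    HQC_sol N p K idx rep coll psi f uH -> hom_sol N p K idx psi f ut ->
    Usharp N (emod uH ut).
  by move=> [uHs _] [uts _]; exact: UHsharp_Usharp (emod_sharp uHs uts).
split; [|split].
(* The Poincare factor times [d / cpsi ^+ 2], with the mesh size taken out of [d]. *)
- exists (c3 * (L / cpsi ^+ 2)).
  move=> N K idx rep coll psi f uH ut N0 mesh per a1 a2 _ _ hqc hom.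
  split; first by apply: (poincare N0); apply: sharp hqc hom.
  rewrite -!(mulrA c3) ler_wpM2l //.
  have := modeling_error_le N0 p0 mesh per a1 _ hqc hom
    (fun k => element_mean_coll_H N0 p0 mesh a1 a2 k).
  by move=> /le_trans; apply; rewrite -/L le_eqVlt; apply: predU1l; ring.
- move=> Ccoll C2; exists (c3 * (2 * C2 / cpsi ^+ 2)), (c3 * (Ccoll * L / cpsi ^+ 2)).
  move=> N K idx rep coll psi f uH ut N0 mesh per a1 a2 _ _ hqc hom coll_mid D2.
  split; first by apply: (poincare N0); apply: sharp hqc hom.
  rewrite -!(mulrA c3) -mulrDr -(mulrA c3) ler_wpM2l //.
  have := modeling_error_le N0 p0 mesh per a1 _ hqc hom
    (fun k kK => element_mean_coll_H2 N0 p0 mesh a1 a2 k Ccoll C2 kK (coll_mid k kK) D2).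
  by move=> /le_trans; apply; rewrite -/L le_eqVlt; apply: predU1l; ring.
move=> N K idx rep coll psi f uH ut N0 mesh per a1 a2 _ _ hqc hom indep.
apply: (H1semi_eq0 N0); first exact: sharp hqc hom.
apply/eqP; rewrite eq_le H1semi_ge0 andbT.
(* Here [psi0] is constant, so the coefficients agree and [d = 0] is admissible. *)
have := modeling_error_le N0 p0 mesh per a1 0 hqc hom.
rewrite !mul0r; apply=> k kK.
have psi0_cst i : psi0 p psi i = psi0 p psi (coll k)%:Z.
  by rewrite /psi0; under eq_bigr do rewrite (indep i (coll k)%:Z).
by apply: (element_mean_dist p0 mesh) => // m _; rewrite psi0_cst subrr normr0.
Qed.
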